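(* Let $P$ be a finite poset, $\mathbb{S}$ a skew field containing an infinite field as a subfield, and $C$ a central element of $\mathbb{S}$. Then $\operatorname{NOR}=\Theta\circ\Delta^{-1}\circ\nabla$ (as partial maps $\mathbb{S}^P\dashrightarrow\mathbb{S}^P$, wherever defined).
   Context: $\mathbb{S}^P$ is the set of labelings $f:P\to\mathbb{S}$; products of maps denote composition, rightmost first. For $x\in\mathbb{S}$, $\overline{x}=x^{-1}$; the parallel sum of $z_1,\dots,z_m$ is $\sum^{\parallel}_i z_i=\overline{\overline{z_1}+\cdots+\overline{z_m}}$. $\widehat P$ is $P$ with a new minimum $\widehat0$ and maximum $\widehat1$; $x\lessdot y$ means $y$ covers $x$ in $\widehat P$. Noncommutative order toggle: $T_v$ changes only the label at $v$: $(T_vf)(v)=\Big(\sum_{u\lessdot v}f(u)\Big)\overline{f(v)}\Big(\sum^{\parallel}_{u\gtrdot v}f(u)\Big)$ with $f(\widehat0)=1$, $f(\widehat1)=C$. $\operatorname{NOR}=T_{x_1}T_{x_2}\cdots T_{x_n}$ for any linear extension $(x_1,\dots,x_n)$ of $P$ (listing with $x_i<x_j\Rightarrow i<j$). Transfer maps: $(\Theta f)(x)=C\,\overline{f(x)}$; $(\nabla f)(x)=f(x)\,\overline{\sum_{y\lessdot x}f(y)}$ with $f(\widehat0)=1$; $(\Delta^{-1}f)(x)=\sum f(y_k)\cdots f(y_2)f(y_1)$ over all chains $x=y_1\lessdot y_2\lessdot\cdots\lessdot y_k\lessdot\widehat1$. *)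

(* Defs.v *)
From HB Require Import structures.
From mathcomp Require Import all_boot all_order all_algebra.

Set Implicit Arguments.
Unset Strict Implicit.
Unset Printing Implicit Defensive.

Import Order.TTheory GRing.Theory.

Local Open Scope ring_scope.

(* [K] is an infinite (commutative) subfield of [S]; [divring_closed] says that
   [K] contains 1 and is closed under subtraction and division. *)
Definition infinite_subfield (S : unitRingType) (K : {pred S}) : Prop :=
  [/\ divring_closed K,
      {in K &, commutative (@GRing.mul S)} &
      forall s : seq S, exists2 x, x \in K & x \notin s].

(* The poset P with a new minimum [Bot] and a new maximum [Top]. *)
Inductive hat (P : Type) : Type := Bot | Elt of P | Top.
Arguments Bot {P}.
Arguments Elt {P} _.
Arguments Top {P}.

Section HatFinite.

Context {T : finType}.

Definition hat_code (x : hat T) : option (option T) :=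
  match x with Bot => None | Elt a => Some (Some a) | Top => Some None end.

Definition hat_decode (o : option (option T)) : hat T :=
  match o with None => Bot | Some (Some a) => Elt a | Some None => Top end.

Lemma hat_codeK : cancel hat_code hat_decode. Proof. by case. Qed.

HB.instance Definition _ := Finite.copy (hat T) (can_type hat_codeK).

End HatFinite.

Section HatPoset.

Context {d : Order.disp_t} {P : finPOrderType d}.

Definition hat_le (x y : hat P) : bool :=
  match x, y with
  | Bot, _ => true
  | _, Top => true
  | Elt a, Elt b => (a <= b)%O
  | _, _ => false
  end.

Fact hat_le_refl : reflexive hat_le.
Proof. by case=> //= a; exact: lexx. Qed.

Fact hat_le_anti : antisymmetric hat_le.
Proof. by case=> [|a|] [|b|] //= /le_anti->. Qed.

Fact hat_le_trans : transitive hat_le.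
Proof. by case=> [|a|] [|b|] [|c|] //=; exact: le_trans. Qed.

HB.instance Definition _ := Order.Le_isPOrder.Build d (hat P)
  hat_le_refl hat_le_anti hat_le_trans.

Lemma hat_ltE (a b : P) : (Elt a < Elt b)%O = (a < b)%O.
Proof. by rewrite !lt_neqAle. Qed.

End HatPoset.

Definition covered_by {d : Order.disp_t} {T : finPOrderType d} (x y : T) : bool :=
  (x < y)%O && ~~ [exists z : T, (x < z)%O && (z < y)%O].

(* The x_i are listed without repetition, and x_i < x_j implies i < j. *)
Definition linear_extension {d : Order.disp_t} {P : finPOrderType d}
    (xs : seq P) : Prop :=
  perm_eq xs (enum P) /\
  forall x y : P, (x < y)%O -> (index x xs < index y xs)%N.

(* A partial map A --> B is a function [A -> option B], where [None] means
   undefined; such maps are composed with [ssrfun.pcomp].  Below, a map is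
   undefined exactly when evaluating its formula requires the inverse of 0. *)
Definition pagree {A B : Type} (F G : A -> option B) : Prop :=
  forall a b c, F a = Some b -> G a = Some c -> b = c.

(* The parallel sum of the [z i] for [i] in [A]; it is defined when every
   [z i] and the sum of their inverses are nonzero. *)
Definition par_sum_defined {S : unitRingType} {I : finType}
    (A : pred I) (z : I -> S) : bool :=
  [forall i, A i ==> (z i != 0)] && (\sum_(i | A i) (z i)^-1 != 0).

Definition par_sum {S : unitRingType} {I : finType}
    (A : pred I) (z : I -> S) : S :=
  (\sum_(i | A i) (z i)^-1)^-1.

Section Labelings.

Context {d : Order.disp_t} {P : finPOrderType d} {S : unitRingType}.
Variable C : S.

Implicit Types f : {ffun P -> S}.

Definition hat_label f (x : hat P) : S :=
  match x with Bot => 1 | Elt a => f a | Top => C end.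

(* [Elt v] never covers [Top], so this does not depend on [C]. *)
Definition lower_sum f (v : P) : S :=
  \sum_(u : hat P | covered_by u (Elt v)) hat_label f u.

Definition upper_par_sum_defined f (v : P) : bool :=
  par_sum_defined (fun u : hat P => covered_by (Elt v) u) (hat_label f).

Definition upper_par_sum f (v : P) : S :=
  par_sum (fun u : hat P => covered_by (Elt v) u) (hat_label f).

Definition toggle (v : P) f : option {ffun P -> S} :=
  if (f v != 0) && upper_par_sum_defined f v then
    Some [ffun x => if x == v
                    then lower_sum f v * (f v)^-1 * upper_par_sum f v
                    else f x]
  else None.

(* [NOR [:: x_1; ...; x_n]] is T_{x_1} ... T_{x_n}, with T_{x_n} applied first. *)
Definition NOR (xs : seq P) : {ffun P -> S} -> option {ffun P -> S} :=
  foldr (fun v F => pcomp (toggle v) F) Some xs.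

Definition Theta f : option {ffun P -> S} :=
  if [forall x, f x != 0] then Some [ffun x => C * (f x)^-1] else None.

Definition Nabla f : option {ffun P -> S} :=
  if [forall x, lower_sum f x != 0]
  then Some [ffun x => f x * (lower_sum f x)^-1]
  else None.

(* [sat_chain x s]: with s = [:: y_2; ...; y_k], one has
   x = y_1 <. y_2 <. ... <. y_k <. Top. *)
Definition sat_chain (x : P) (s : seq P) : bool :=
  path (fun y z => covered_by (Elt y) (Elt z)) x s
    && covered_by (Elt (last x s)) Top.

(* The tail of a chain has fewer than #|P| elements (see
   [size_sat_chain]), so the sum ranges over all chains. *)
Definition Delta_inv f : option {ffun P -> S} :=
  Some [ffun x => \sum_(k < #|P|) \sum_(s : k.-tuple P | sat_chain x s)
                    \prod_(y <- rev (x :: s)) f y].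

Lemma size_sat_chain (x : P) (s : seq P) : sat_chain x s -> (size s < #|P|)%N.
Proof.
case/andP=> xs _; have {xs} : path <%O x s.
  by apply: sub_path xs => y z /andP[]; rewrite hat_ltE.
move=> xs; have: uniq (x :: s) by apply: (lt_sorted_uniq (s := x :: s)).
by move/card_uniqP => /= <-; exact: max_card.
Qed.

End Labelings.

(* Main.v *)
(** Both sides are characterised by the same system of equations.  Write [L]
    for the lower sums of [f].  As a linear extension is toggled from the top
    down, [NOR f = f'] says exactly that
    [f' v = L v * (f v)^-1 * par_sum (f' u)_(u covers v)], all inverses being
    defined.  On the other side, [h := Delta_inv (Nabla f)] is the unique
    solution of [h v = (\sum_(u covers v) h u) * f v * (L v)^-1] with [h Top = 1],
    and since [C] is central this is the same system under [f' = C * h^-1].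
    The toggles never invert [L v], but [NOR f] is undefined when [L v = 0]:
    then [f' v = 0] and [v] is not minimal, so the later toggle at an element
    covered by [v] inverts [0]. *)
Require Import Defs.
From HB Require Import structures.
From mathcomp Require Import all_boot all_order all_algebra.

Set Implicit Arguments.
Unset Strict Implicit.
Unset Printing Implicit Defensive.

Import Order.TTheory GRing.Theory.

Local Open Scope ring_scope.

(** * Existence of covers and descending induction in a finite poset *)

Section Covers.

Context {d : Order.disp_t} {T : finPOrderType d}.
Implicit Types x y z : T.

Lemma covered_by_lt x y : covered_by x y -> (x < y)%O.
Proof. by case/andP. Qed.

(** Among the elements of [[x, y)], one with the largest down-set is covered by [y]: an element
    strictly between the two would have a larger down-set. *)
Lemma lower_cover_exists x y :
  (x < y)%O -> exists2 z, covered_by z y & (x <= z)%O.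
Proof.
move=> xy; pose Q z := (x <= z)%O && (z < y)%O.
have Qx : Q x by rewrite /Q lexx.
case: (arg_maxnP (fun z => #|[set w | (w <= z)%O]|) Qx) => z /andP[xz zy] zmax.
exists z => //; rewrite /covered_by zy; apply/existsP => -[w /andP[zw wy]].
have /zmax : Q w by rewrite /Q wy (le_trans xz (ltW zw)).
rewrite /= leqNgt => /negP[]; apply/proper_card/properP; split.
  by apply/subsetP => t; rewrite !inE => /le_trans; apply; exact: ltW.
by exists w; rewrite !inE ?lexx // lt_geF.
Qed.

Lemma finPOrder_gt_ind (Q : T -> Prop) :
  (forall x, (forall y, (x < y)%O -> Q y) -> Q x) -> forall x, Q x.
Proof.
move=> IH x; have [n] := ubnP #|[set y | (x < y)%O]|.
elim: n x => // n IHn x le_n; apply: IH => y xy; apply: IHn.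
rewrite -ltnS; apply: leq_trans le_n; rewrite ltnS.
apply/proper_card/properP; split.
  by apply/subsetP => t; rewrite !inE; exact: lt_trans.
by exists y; rewrite !inE ?ltxx.
Qed.

End Covers.

(** * Covers in the poset extended by [Bot] and [Top] *)

Section HatCovers.

Context {d : Order.disp_t} {P : finPOrderType d}.

Lemma covered_by_Bot (u : hat P) : covered_by u Bot = false.
Proof. by apply/negP => /covered_by_lt; rewrite lt_neqAle; case: u. Qed.

Lemma Top_covered_by (u : hat P) : covered_by Top u = false.
Proof. by apply/negP => /covered_by_lt; rewrite lt_neqAle; case: u. Qed.

(** Isolating [Top] separates the chain that stops at [x] from those that continue inside [P]. *)
Lemma big_upper_covers (R : nmodType) (F : hat P -> R) (x : P) :
  \sum_(u | covered_by (Elt x) u) F u =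
  (if covered_by (Elt x) Top then F Top else 0) +
  \sum_(y | covered_by (Elt x) (Elt y)) F (Elt y).
Proof.
rewrite (bigID (pred1 Top)) /=; congr (_ + _).
  case: ifP => cx; [apply: big_pred1 | apply: big_pred0] => u /=.
    by rewrite andbC; case: eqP => // ->.
  by rewrite andbC; case: eqP => // ->.
pose h u := if u is Elt y then Some y else None : option P.
rewrite (reindex_omap Elt h) /=; last first.
  by case=> [|y|] //=; rewrite ?covered_by_Bot ?eqxx ?andbF.
by apply: eq_bigl => y; rewrite eqxx andbT andbT.
Qed.

End HatCovers.

(** * The composite of toggles as a system of equations *)

Section NORSystem.

Context {d : Order.disp_t} {P : finPOrderType d} {S : unitRingType}.
Variable C : S.
Implicit Types (f g : {ffun P -> S}) (v : P) (xs : seq P).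

(** When [v] is toggled, the elements above it already carry their final labels [g], while [v] and
    the elements below it still carry [f]. *)
Definition NOR_eqs_at f g v : Prop :=
  [/\ f v != 0, upper_par_sum_defined C g v &
      g v = lower_sum C f v * (f v)^-1 * upper_par_sum C g v].

Lemma eq_lower_sum f g v :
  (forall u, (u < v)%O -> f u = g u) -> lower_sum C f v = lower_sum C g v.
Proof.
move=> fg; apply: eq_bigr => -[|u|] //= /covered_by_lt.
by rewrite hat_ltE => /fg.
Qed.

Lemma eq_upper_par_sum f g v : (forall u, (v < u)%O -> f u = g u) ->
  upper_par_sum_defined C f v = upper_par_sum_defined C g v /\
  upper_par_sum C f v = upper_par_sum C g v.
Proof.
move=> fg.
have fg_hat u : covered_by (Elt v) u -> hat_label C f u = hat_label C g u.
  by case: u => [|u|] //= /covered_by_lt; rewrite hat_ltE => /fg.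
have eq_inv : \sum_(u | covered_by (Elt v) u) (hat_label C f u)^-1 =
              \sum_(u | covered_by (Elt v) u) (hat_label C g u)^-1.
  by apply: eq_bigr => u /fg_hat ->.
rewrite /upper_par_sum_defined /par_sum_defined /upper_par_sum /par_sum eq_inv.
split=> //; congr (_ && _); apply: eq_forallb => u.
by case cu: (covered_by _ _) => //=; rewrite fg_hat.
Qed.

Lemma NOR_eqs_at_eq f g g' v : (forall u, (v <= u)%O -> g u = g' u) ->
  NOR_eqs_at f g v -> NOR_eqs_at f g' v.
Proof.
move=> gg'; have [|dE pE] := @eq_upper_par_sum g g' v.
  by move=> u /ltW /gg'.
by rewrite /NOR_eqs_at dE pE gg'.
Qed.

(* [xs] is a final segment of a linear extension. *)
Definition linear_filter xs : Prop :=
  [/\ uniq xs, pairwise (fun x y => ~~ (y < x)%O) xs &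
      forall x y, x \in xs -> (x < y)%O -> y \in xs].

Lemma linear_filter_cons v xs : linear_filter (v :: xs) ->
  [/\ linear_filter xs, v \notin xs,
      forall u, (u < v)%O -> u \notin v :: xs &
      forall u, (v < u)%O -> u \in xs].
Proof.
case=> /= /andP[v_xs uniq_xs] /andP[/allP v_min xs_pw] xs_up.
split=> // [|u uv|u vu].
- split=> // x y x_xs xy.
  have: y \in v :: xs by apply: xs_up xy; rewrite inE x_xs orbT.
  rewrite inE => /predU1P[yv|//].
  by move: (v_min _ x_xs); rewrite -yv xy.
- rewrite inE (lt_eqF uv) /=; apply/negP => /v_min.
  by rewrite uv.
have := xs_up v u (mem_head _ _) vu.
by rewrite inE (gt_eqF vu).
Qed.

(** Induction on [xs], whose head [v] is toggled last. The equations at the tail involve [g] only on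
    an up-closed set avoiding [v], so this toggle preserves them; the clause outside [xs] supplies
    the untouched labels in the lower sum at [v]. *)
Lemma NOR_linear_filter xs f g : linear_filter xs ->
  NOR C xs f = Some g <->
  {in xs, forall v, NOR_eqs_at f g v} /\
  {in [predC xs], forall v, g v = f v}.
Proof.
elim: xs g => [|v xs IH] g /=.
  move=> _; split=> [[<-] //|[_ gf]]; congr Some; apply/ffunP => v.
  by rewrite gf.
case/linear_filter_cons => xs_filter v_xs v_lower v_upper.
have toggled g' : {in [predC xs], forall u, g' u = f u} ->
    f v = g' v /\ lower_sum C g' v = lower_sum C f v.
  move=> g'f; split; first by rewrite g'f.
  apply: eq_lower_sum => u /v_lower; rewrite inE => /norP[_ u_xs].
  by rewrite g'f.
split.
  rewrite /pcomp; case def_g': (NOR C xs f) => [g'|] //=.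
  have /(IH g' xs_filter) [g'_eqs g'f] := def_g'.
  have [fv fL] := toggled g' g'f.
  rewrite /toggle fL -fv; case: ifP => // /andP[fv0 v_def] [def_g].
  have gg' u : u != v -> g u = g' u by rewrite -def_g ffunE => /negPf->.
  have [|dE pE] := @eq_upper_par_sum g g' v.
    by move=> u vu; rewrite gg' // gt_eqF.
  split=> u; rewrite inE; last first.
    by rewrite inE => /norP[uv u_xs]; rewrite gg' // g'f.
  case/predU1P=> [->|u_xs].
    by split; rewrite ?dE ?pE // -def_g ffunE eqxx.
  apply: NOR_eqs_at_eq (g'_eqs u u_xs) => w uw; rewrite gg' //.
  (* [w] stays in [xs], which is closed upwards, so it differs from [v]. *)
  apply: contraNneq v_xs => <-; move: uw; rewrite le_eqVlt.
  case/predU1P => [<- //|uw]; have [_ _ xs_up] := xs_filter.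
  exact: xs_up uw.
case=> g_eqs gf.
(* The labeling just before the toggle at [v]. *)
pose g' : {ffun P -> S} := [ffun u => if u == v then f v else g u].
have gg' u : u != v -> g u = g' u by rewrite ffunE => /negPf->.
have g'f : {in [predC xs], forall u, g' u = f u}.
  move=> u u_xs; rewrite ffunE; case: eqP => [-> //|/eqP uv].
  by apply: gf; rewrite !inE negb_or uv.
have /(IH g' xs_filter) def_g' : {in xs, forall u, NOR_eqs_at f g' u} /\
    {in [predC xs], forall u, g' u = f u}.
  split=> // u u_xs; apply: NOR_eqs_at_eq (g_eqs u _) => [w uw|]; last first.
    by rewrite inE u_xs orbT.
  rewrite gg' //.
  apply: contraNneq v_xs => <-; move: uw; rewrite le_eqVlt.
  case/predU1P => [<- //|uw]; have [_ _ xs_up] := xs_filter.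
  exact: xs_up uw.
have [fv fL] := toggled g' g'f.
have [|dE pE] := @eq_upper_par_sum g g' v.
  by move=> u vu; rewrite gg' // gt_eqF.
have [fv0 v_def gv] := g_eqs v (mem_head _ _).
rewrite /pcomp def_g' /= /toggle -fv fv0 -dE v_def fL -pE /=.
congr Some; apply/ffunP => u; rewrite ffunE.
by case: eqP => [->|/eqP uv] //; rewrite gg'.
Qed.

Lemma linear_extension_filter xs : linear_extension xs -> linear_filter xs.
Proof.
case=> xs_enum xs_index.
have uniq_xs : uniq xs by rewrite (perm_uniq xs_enum) enum_uniq.
have mem_xs x : x \in xs by rewrite (perm_mem xs_enum) mem_enum.
split=> //.
case: xs => // x0 xs in xs_enum xs_index uniq_xs mem_xs *.
apply/(pairwiseP x0) => i j i_lt j_lt ij; apply/negP => /xs_index.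
by rewrite !index_uniq // ltnNge ltnW.
Qed.

Lemma NOR_linear_extension xs f g : linear_extension xs ->
  NOR C xs f = Some g <-> forall v, NOR_eqs_at f g v.
Proof.
move=> xs_lin; have mem_xs x : x \in xs.
  by rewrite (perm_mem xs_lin.1) mem_enum.
apply: (iff_trans (NOR_linear_filter _ _ (linear_extension_filter xs_lin))).
by split=> [[g_eqs _] v|g_eqs]; [exact: g_eqs|split=> v; rewrite ?inE ?mem_xs].
Qed.

End NORSystem.

(** * Sums over saturated chains up to [Top] *)

Section ChainSum.

Context {d : Order.disp_t} {P : finPOrderType d} {S : unitRingType}.
Implicit Types (f g h : {ffun P -> S}) (x y : P).

(** The inner sum of [Delta_inv]; [n] counts the elements of [P] after [x]. *)
Definition chain_sum g (n : nat) x : S :=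
  \sum_(s : n.-tuple P | sat_chain x s) \prod_(y <- rev (x :: s)) g y.

Lemma chain_sum0 g x :
  chain_sum g 0 x = if covered_by (Elt x) Top then g x else 0.
Proof.
rewrite /chain_sum; case: ifP => cx.
  rewrite (big_pred1 [tuple]) => [|s]; first by rewrite big_seq1.
  by rewrite tuple0 /sat_chain /= cx eqxx.
by rewrite big_pred0 // => s; rewrite tuple0 /sat_chain /= cx.
Qed.

(** The product runs backwards along the chain, so removing the first element [x] takes out the
    rightmost factor. *)
Lemma chain_sumS g n x : chain_sum g n.+1 x =
  \sum_(y | covered_by (Elt x) (Elt y)) chain_sum g n y * g x.
Proof.
rewrite /chain_sum; under [RHS]eq_bigr do rewrite big_distrl /=.
rewrite pair_big_dep /=.
rewrite (reindex (fun p : P * n.-tuple P => [tuple of p.1 :: p.2])) /=.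
  apply: eq_big => [[y s]|[y s] _] /=; first by rewrite /sat_chain /= andbA.
  by rewrite rev_cons big_rcons.
exists (fun s => (thead s, [tuple of behead s])) => [[y s] _|s _] /=.
  by congr (_, _); apply: val_inj.
by rewrite -tuple_eta.
Qed.

Lemma chain_sum_card g x : chain_sum g #|P| x = 0.
Proof.
apply: big_pred0 => s; apply/negP => /size_sat_chain.
by rewrite size_tuple ltnn.
Qed.

Definition chain_eqs g h : Prop :=
  forall x, h x = (\sum_(u | covered_by (Elt x) u) hat_label 1 h u) * g x.

Lemma Delta_inv_chain_eqs g h : Delta_inv g = Some h -> chain_eqs g h.
Proof.
case=> def_h x.
have hE y : h y = \sum_(k < #|P|) chain_sum g k y by rewrite -def_h ffunE.
rewrite big_upper_covers /= mulrDl big_distrl /= hE.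
(* The added last term is zero; splitting off [k = 0] then leaves exactly [#|P|] terms for the
   recursion. *)
transitivity (\sum_(k < #|P|.+1) chain_sum g k x).
  by rewrite big_ord_recr /= chain_sum_card addr0.
rewrite big_ord_recl /= chain_sum0.
congr (_ + _); first by case: ifP; rewrite ?mul1r ?mul0r.
under eq_bigr do rewrite chain_sumS.
by rewrite exchange_big /=; apply: eq_bigr => y _; rewrite hE big_distrl.
Qed.

(** Each equation determines [h x] from labels strictly above [x]. *)
Lemma chain_eqs_uniq g h h' : chain_eqs g h -> chain_eqs g h' -> h = h'.
Proof.
move=> h_eqs h'_eqs; apply/ffunP; apply: finPOrder_gt_ind => x IH.
rewrite h_eqs h'_eqs; congr (_ * _).
by apply: eq_bigr => -[|y|] //= /covered_by_lt; rewrite hat_ltE => /IH.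
Qed.

End ChainSum.

(** * Inverses and products in a skew field *)

Section SkewField.

Context {S : unitRingType}.
Hypothesis S_skew : GRing.field_axiom S.
Implicit Types x y : S.

Lemma skew_unitE x : (x \is a GRing.unit) = (x != 0).
Proof.
by apply/idP/idP => [|/S_skew //]; apply: contraTneq => ->; rewrite unitr0.
Qed.

Lemma skew_mulf_neq0 x y : (x * y != 0) = (x != 0) && (y != 0).
Proof.
apply/idP/andP => [xy|[x0 y0]].
  by split; apply: contraNneq xy => ->; rewrite ?mul0r ?mulr0.
by rewrite -skew_unitE unitrMl skew_unitE.
Qed.

Lemma skew_invr_neq0 x : (x^-1 != 0) = (x != 0).
Proof. by rewrite -!skew_unitE unitrV. Qed.

Lemma skew_invrM x y : x != 0 -> y != 0 -> (x * y)^-1 = y^-1 * x^-1.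
Proof. by move=> x0 y0; apply: invrM; exact: S_skew. Qed.

End SkewField.

(** * Translation between the toggle system and the chain system *)

Section TransferSystem.

Context {d : Order.disp_t} {P : finPOrderType d} {S : unitRingType}.
Hypothesis S_skew : GRing.field_axiom S.
Variable C : S.
Hypothesis C_central : forall x : S, C * x = x * C.
Implicit Types (f g h : {ffun P -> S}) (v : P).

Lemma NOR_eqs_lower_neq0 f g :
  (forall v, NOR_eqs_at C f g v) -> forall v, lower_sum C f v != 0.
Proof.
move=> g_eqs v.
have [a /= av|no_cover] := pickP (fun a => covered_by (Elt a) (Elt v)).
  have [_ /andP[/forallP/(_ (Elt v)) + _] _] := g_eqs a.
  rewrite av /=; have [_ _ ->] := g_eqs v.
  by rewrite !skew_mulf_neq0 // => /andP[/andP[]].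
have [|u uv _] := @lower_cover_exists _ (hat P) Bot (Elt v).
  by rewrite lt_neqAle.
(* With no lower cover in [P], only [Bot] is covered by [v], and its label is 1. *)
suff -> : lower_sum C f v = 1 by rewrite oner_eq0.
rewrite /lower_sum (big_pred1 Bot) // => -[|a|];
  rewrite ?no_cover ?Top_covered_by //.
case: u uv => [|a|] //; first by rewrite no_cover.
Qed.

Hypothesis C_neq0 : C != 0.

Lemma Theta_involutive_at x : C * (C * x^-1)^-1 = x.
Proof.
have [->|x0] := eqVneq x 0; first by rewrite !invr0 !mulr0 invr0 mulr0.
rewrite skew_invrM ?skew_invr_neq0 // invrK C_central -mulrA mulVr ?mulr1 //.
exact: S_skew.
Qed.

(** Inverting [C * h^-1] gives [h * C^-1], so the parallel sum of [g] is [C] times the inverse of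
    the ordinary sum [U] of [h]. Centrality of [C] then matches the two right-hand sides. *)
Lemma transfer_eqs f h g :
  (forall v, lower_sum C f v != 0) -> (forall v, h v != 0) ->
  (forall v, g v = C * (h v)^-1) ->
  (forall v, NOR_eqs_at C f g v) <->
  chain_eqs [ffun v => f v * (lower_sum C f v)^-1] h.
Proof.
move=> L0 h0 gE.
have h_hat0 u : hat_label 1 h u != 0 by case: u => [|u|] //=; rewrite oner_eq0.
(* The label 1 of [Top] corresponds to [C]; [Bot] is excluded, being labelled 1 on both sides. *)
have g_hat u : u != Bot -> hat_label C g u = C * (hat_label 1 h u)^-1.
  by case: u => [|u|] //=; rewrite invr1 mulr1.
have cover_neq v u : covered_by (Elt v) u -> u != Bot.
  by case: u => //; rewrite covered_by_Bot.
pose U v := \sum_(u | covered_by (Elt v) u) hat_label 1 h u.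
have g_sum v : \sum_(u | covered_by (Elt v) u) (hat_label C g u)^-1 = U v * C^-1.
  rewrite /U big_distrl /=; apply: eq_bigr => u /cover_neq u0.
  by rewrite g_hat // skew_invrM ?skew_invr_neq0 // invrK.
have g_def v : upper_par_sum_defined C g v = (U v != 0).
  rewrite /upper_par_sum_defined /par_sum_defined g_sum skew_mulf_neq0 //.
  rewrite skew_invr_neq0 // C_neq0 andbT andb_idl // => _.
  apply/forallP => u; apply/implyP => /cover_neq u0.
  by rewrite g_hat // skew_mulf_neq0 // skew_invr_neq0 // C_neq0 h_hat0.
have g_par v : U v != 0 -> upper_par_sum C g v = C * (U v)^-1.
  move=> U0; rewrite /upper_par_sum /par_sum g_sum.
  by rewrite skew_invrM ?skew_invr_neq0 // invrK.
have C_inj : injective (fun x : S => C * x^-1).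
  by move=> x y xy; rewrite -[x]Theta_involutive_at xy Theta_involutive_at.
have rhsE v : f v != 0 -> U v != 0 ->
    lower_sum C f v * (f v)^-1 * upper_par_sum C g v =
    C * (U v * (f v * (lower_sum C f v)^-1))^-1.
  move=> f0 U0; rewrite g_par //.
  rewrite !skew_invrM ?skew_mulf_neq0 ?skew_invr_neq0 ?f0 ?L0 //.
  by rewrite invrK mulrA -C_central !mulrA.
split=> eqs v.
  have [f0 + gv] := eqs v; rewrite g_def => U0; rewrite ffunE.
  by apply: C_inj; rewrite /= -gE gv rhsE.
have := eqs v; rewrite ffunE -/(U v) => hv.
(* Since [h v] is a nonzero product, its factors yield all the definedness conditions. *)
have := h0 v; rewrite hv !skew_mulf_neq0 // => /and3P[U0 f0 _].
by split; rewrite ?g_def // gE hv rhsE.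
Qed.

Lemma transfer_NOR_eqs f g :
  pcomp (Theta C) (pcomp Delta_inv (Nabla C)) f = Some g <->
  forall v, NOR_eqs_at C f g v.
Proof.
rewrite /pcomp /Nabla; split.
  case: ifP => // /forallP L0; rewrite [obind Delta_inv _]/=.
  set t := [ffun _ => _]; case def_h: (Delta_inv t) => [h|] //=.
  rewrite /Theta; case: ifP => // /forallP h0 [<-].
  by apply/(transfer_eqs L0 h0) => [v|];
    [rewrite ffunE|exact: Delta_inv_chain_eqs].
move=> g_eqs; have L0 := NOR_eqs_lower_neq0 g_eqs.
(* As [Theta] is an involution, [k] is the labeling that it must send to [g]; uniqueness identifies
   it with the chain sums. *)
pose k : {ffun P -> S} := [ffun v => C * (g v)^-1].
have g0 v : g v != 0.
  have [f0 /andP[_ U0] ->] := g_eqs v.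
  by rewrite !skew_mulf_neq0 // !skew_invr_neq0 // L0 f0.
have k0 v : k v != 0.
  by rewrite ffunE skew_mulf_neq0 // skew_invr_neq0 // C_neq0 g0.
have gE v : g v = C * (k v)^-1 by rewrite ffunE Theta_involutive_at.
have k_eqs := (transfer_eqs L0 k0 gE).1 g_eqs.
have -> : [forall x, lower_sum C f x != 0] by apply/forallP.
rewrite [obind Delta_inv _]/=.
set t := [ffun _ => _]; case def_h: (Delta_inv t) => [h|] //=.
have -> := chain_eqs_uniq (Delta_inv_chain_eqs def_h) k_eqs.
rewrite /Theta; case: ifP => [_|/forallP[]//].
by congr Some; apply/ffunP => v; rewrite ffunE -gE.
Qed.

End TransferSystem.

(** * Comparison of the two partial maps *)

Theorem theorem5p12 (d : Order.disp_t) (P : finPOrderType d)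
    (S : unitRingType) (S_skew : GRing.field_axiom S)
    (K : {pred S}) (K_inf : infinite_subfield K)
    (C : S) (C_central : forall x : S, C * x = x * C)
    (xs : seq P) (xs_linext : linear_extension xs) :
  pagree (NOR C xs) (pcomp (Theta C) (pcomp Delta_inv (Nabla C))) /\
  (C != 0 -> NOR C xs =1 pcomp (Theta C) (pcomp Delta_inv (Nabla C))).
Proof.
have eq_maps : C != 0 ->
    NOR C xs =1 pcomp (Theta C) (pcomp Delta_inv (Nabla C)).
  move=> C0 f; have NORP g := NOR_linear_extension C f g xs_linext.
  have transferP g := transfer_NOR_eqs S_skew C_central C0 f g.
  case def_g: (pcomp _ _ f) => [g|]; first exact/NORP/transferP.
  case def_g': (NOR C xs f) => [g'|] //.
  by have /NORP/transferP := def_g'; rewrite def_g.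
split=> // f g g' fg; have [C0|/eq_maps <-] := eqVneq C 0; last first.
  by rewrite fg => -[].
(* Extensionality provides an element [v], which settles the empty poset; a lower cover of [Top]
   above [v] is then a maximal element. *)
move=> _; apply/ffunP => v.
(* For C = 0 the toggle at a maximal element is undefined. *)
have [|[|a|] // aT _] := @lower_cover_exists _ (hat P) (Elt v) Top.
  by rewrite lt_neqAle.
have /(NOR_linear_extension C f g xs_linext)/(_ a) := fg.
by case=> _ /andP[/forallP/(_ Top)]; rewrite aT /= C0 eqxx.
Qed.
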